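(* Let $n$ be a positive integer and $\mathbf b=(b_1,\dots,b_n)\in\mathbb Z_{>0}^n$, and assume that it is not the case that $n=1=b_1$. Then: (a) The polytope $\mathfrak X_n(\mathbf b)$ is simple. (b) The set of vertices of $\mathfrak X_n(\mathbf b)$ is $\{\pi(\mathbf v_k) : \pi\in\mathfrak S_n,\ 0\le k\le n\}$. (c) The minimal inequality description of $\mathfrak X_n(\mathbf b)$ is the set of points $(x_1,\dots,x_n)\in\mathbb R^n$ such that $x_i\ge 1$ for $1\le i\le n$ and $$\sum_{i\in I}x_i\ \le\ \sum_{i=n-|I|+1}^{n}S_i,\qquad\text{or, equivalently,}\qquad \sum_{i\in I}x_i\ \le\ \sum_{j=1}^n\min\{j,|I|\}\,b_{n-j+1},$$ for all nonempty $I\subseteq[n]$ if $b_1\ge 2$, and for all nonempty $I\subseteq[n]$ with $|I|\ne n-1$ if $b_1=1$. In other words, these inequalities are precisely the facet-defining inequalities for $\mathfrak X_n(\mathbf b)$.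
   Context: A $\mathbf b$-parking function is a list $(\beta_1,\dots,\beta_n)$ of positive integers whose nondecreasing rearrangement $\beta'_1\le\cdots\le\beta'_n$ satisfies $\beta'_i\le b_1+\cdots+b_i$ for all $i$. The $\mathbf b$-parking-function polytope $\mathfrak X_n(\mathbf b)\subset\mathbb R^n$ is the convex hull of all $\mathbf b$-parking functions. Write $[n]=\{1,\dots,n\}$, $S_i=\sum_{j=1}^i b_j$ for $1\le i\le n$, and $\mathbf v_k=(1,\dots,1,S_{k+1},S_{k+2},\dots,S_n)\in\mathbb R^n$ for $0\le k\le n$ (the first $k$ entries are $1$). The symmetric group $\mathfrak S_n$ acts linearly on $\mathbb R^n$ by $\pi\left(\sum_i a_i\mathbf e_i\right)=\sum_i a_i\mathbf e_{\pi(i)}$. An $n$-dimensional polytope is simple if each of its vertices is incident to exactly $n$ edges. An inequality description of a polytope is minimal if none of its inequalities can be omitted without changing the set described. *)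

(* Defs.v *)
From HB Require Import structures.
From mathcomp Require Import all_boot all_order all_fingroup all_algebra.
From mathcomp Require Import all_classical all_reals.
From mathcomp Require Import convex.

Set Implicit Arguments.
Unset Strict Implicit.
Unset Printing Implicit Defensive.

Import Order.TTheory GRing.Theory Num.Theory.

Local Open Scope classical_set_scope.
Local Open Scope ring_scope.

Section Polytopes.
Variables (R : realType) (n : nat).
Implicit Types (A P F : set 'rV[R]_n) (v : 'rV[R]_n).

Definition convex_hull A : set 'rV[R]_n := smallest (@convex_set R 'rV[R]_n) A.

(* The affine dimension of a nonempty set: the dimension of the span of the
   differences of its points. *)
Definition has_dim A (d : nat) : Prop :=
  A !=set0 /\
  exists U : {vspace 'rV[R]_n},
    [/\ \dim U = d,
        (forall x y, A x -> A y -> x - y \in U) &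
        forall V : {vspace 'rV[R]_n},
          (forall x y, A x -> A y -> x - y \in V) -> (U <= V)%VS].

(* A pair h stands for the linear inequality <h.1, x> <= h.2. *)
Definition linear_ineq : Type := 'rV[R]_n * R.
Implicit Types (h : linear_ineq) (L : set linear_ineq).

Definition dot (a x : 'rV[R]_n) : R := \sum_(i < n) a 0 i * x 0 i.

Definition halfspace h : set 'rV[R]_n := [set x | dot h.1 x <= h.2].
Definition hyperplane h : set 'rV[R]_n := [set x | dot h.1 x = h.2].

Definition solutions L : set 'rV[R]_n := \bigcap_(h in L) halfspace h.

Definition valid P h : Prop := P `<=` halfspace h.

(* P itself (h = (0, 0)) and the empty set (h = (0, 1)) are faces of P. *)
Definition face P F : Prop :=
  exists2 h, valid P h & F = P `&` hyperplane h.

Definition vertices P : set 'rV[R]_n := [set v | face P [set v]].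

Definition edge P F : Prop := face P F /\ has_dim F 1.

Definition facet P F : Prop :=
  face P F /\ exists d, has_dim P d.+1 /\ has_dim F d.

Definition facet_defining P h : Prop :=
  valid P h /\ facet P (P `&` hyperplane h).

Definition simple_polytope (d : nat) P : Prop :=
  has_dim P d /\
  forall v, vertices P v -> ([set F | edge P F /\ F v] #= `I_d)%card.

Definition minimal_description P L : Prop :=
  P = solutions L /\ forall h, L h -> solutions (L `\ h) <> P.

Definition perm_act (s : {perm 'I_n}) v : 'rV[R]_n :=
  \sum_(i < n) v 0 i *: delta_mx 0 (s i).

End Polytopes.

(* b_j with 1-based j. *)
Definition part n (b : n.-tuple nat) (j : nat) : nat := nth 0%N b j.-1.

Definition psum n (b : n.-tuple nat) (i : nat) : nat :=
  (\sum_(1 <= j < i.+1) part b j)%N.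

Definition parking_function n (b beta : n.-tuple nat) : Prop :=
  (forall i : 'I_n, (0 < tnth beta i)%N) /\
  forall i, (1 <= i <= n)%N -> (nth 0 (sort leq beta) i.-1 <= psum b i)%N.

Definition parking_polytope (R : realType) n (b : n.-tuple nat) :
    set 'rV[R]_n :=
  convex_hull [set \row_(i < n) (tnth beta i)%:R
              | beta in [set beta | parking_function b beta]].
Arguments parking_polytope R {n} b _.

(* The (0-based) coordinate i is the (i + 1)-st entry of v_k. *)
Definition vk (R : realType) n (b : n.-tuple nat) (k : nat) : 'rV[R]_n :=
  \row_(i < n) if (i < k)%N then 1 else (psum b i.+1)%:R.

Definition lower_ineq (R : realType) n (i : 'I_n) : linear_ineq R n :=
  (- delta_mx 0 i, -1).

Definition upper_ineq (R : realType) n (b : n.-tuple nat) (I : {set 'I_n}) :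
    linear_ineq R n :=
  (\row_(i < n) (i \in I)%:R,
   (\sum_(n - #|I| + 1 <= i < n.+1) psum b i)%N%:R).

Definition parking_ineqs (R : realType) n (b : n.-tuple nat) :
    set (linear_ineq R n) :=
  [set lower_ineq R i | i in [set: 'I_n]] `|`
  [set upper_ineq R b I
  | I in [set I : {set 'I_n} |
          (0 < #|I|)%N /\ (part b 1 = 1%N -> #|I| <> n.-1)]].
Arguments parking_ineqs R {n} b _.

(* Main.v *)
(* The argument is local: at every permutation v of some v_k there are n
   inequalities of the list, tight at v, whose normals are dual, up to sign, to
   n directions leading from v to other permutations of the v_k (swap two
   neighbouring partial sums, or trade one of them for a 1). So the polytope
   lies in the simplicial cone spanned at v by these directions, and this one
   picture yields the n edges at v, the exposedness of v, the fact that every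
   nonempty face contains such a point (optimality over the neighbours is
   global, as in the simplex method), and the facets.

   That the inequalities cut out no more than the convex hull is weak
   majorization by (S_1, .., S_n), in the manner of Hardy-Littlewood-Polya. *)
Require Import Defs.
From mathcomp Require Import all_boot all_order all_fingroup all_algebra.
From mathcomp Require Import all_classical all_reals.
From mathcomp Require Import interval_inference convex ring lra zify.

Set Implicit Arguments.
Unset Strict Implicit.
Unset Printing Implicit Defensive.

Import Order.TTheory GRing.Theory Num.Theory.

Local Open Scope classical_set_scope.
Local Open Scope ring_scope.

(** * Simplicial cones at the vertices of a polytope *)

Section Hull.
Variables (R : realType) (n : nat).
Implicit Types (A B P : set 'rV[R]_n) (x y a v : 'rV[R]_n) (h : linear_ineq R n).

Lemma convex_setP A :
  @convex_set R 'rV[R]_n A <->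
  forall x y (t : R), A x -> A y -> 0 <= t <= 1 -> A (t *: x + (1 - t) *: y).
Proof.
split=> [cA x y t Ax Ay /andP[t0 t1]|cA x y l].
  have := cA x y (Itv01 t0 t1); rewrite !inE => /(_ Ax Ay); exact.
rewrite !inE => Ax Ay; apply: cA => //; apply/andP; split; [exact: ge0|exact: le1].
Qed.

Lemma convex_hull_convex A x y (t : R) :
  convex_hull A x -> convex_hull A y -> 0 <= t <= 1 ->
  convex_hull A (t *: x + (1 - t) *: y).
Proof.
move=> Ax Ay t01 B [cB AB]; move/convex_setP: (cB); apply => //.
- exact: Ax.
- exact: Ay.
Qed.

Lemma sub_convex_hull A : A `<=` convex_hull A.
Proof. exact: sub_gen_smallest. Qed.

Lemma convex_hull_min A B :
  (forall x y (t : R), B x -> B y -> 0 <= t <= 1 -> B (t *: x + (1 - t) *: y)) ->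
  A `<=` B -> convex_hull A `<=` B.
Proof. by move=> /convex_setP cB; apply: smallest_sub. Qed.

Lemma dotC a x : dot a x = dot x a.
Proof. by apply: eq_bigr => i _; rewrite mulrC. Qed.

Lemma dotDr a x y : dot a (x + y) = dot a x + dot a y.
Proof. by rewrite -big_split; apply: eq_bigr => i _; rewrite mxE mulrDr. Qed.

Lemma dotZr a (t : R) x : dot a (t *: x) = t * dot a x.
Proof. by rewrite mulr_sumr; apply: eq_bigr => i _; rewrite mxE mulrCA. Qed.

Lemma dotNr a x : dot a (- x) = - dot a x.
Proof. by rewrite -scaleN1r dotZr mulN1r. Qed.

Lemma dotBr a x y : dot a (x - y) = dot a x - dot a y.
Proof. by rewrite dotDr dotNr. Qed.

Lemma dotZl a (t : R) x : dot (t *: a) x = t * dot a x.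
Proof. by rewrite dotC dotZr dotC. Qed.

Lemma dot0l x : dot 0 x = 0.
Proof. by rewrite -(scale0r 0) dotZl mul0r. Qed.

Lemma dot_sumr (I : Type) (r : seq I) (Q : pred I) (F : I -> 'rV[R]_n) a :
  dot a (\sum_(i <- r | Q i) F i) = \sum_(i <- r | Q i) dot a (F i).
Proof.
elim/big_ind2: _ => // [|x1 y1 x2 y2 <- <-]; last by rewrite dotDr.
by rewrite dotC dot0l.
Qed.

Lemma dot_delta a (i : 'I_n) : dot a (delta_mx 0 i) = a 0 i.
Proof.
rewrite /dot (bigD1 i) //= big1 ?addr0 ?mxE ?eqxx ?mulr1 // => j ji.
by rewrite mxE (negPf ji) andbF mulr0.
Qed.

Lemma convex_hull_halfspace A h : A `<=` halfspace h -> convex_hull A `<=` halfspace h.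
Proof.
apply: convex_hull_min => x y t /= hx hy /andP[t0 t1].
rewrite /halfspace/= dotDr !dotZr -[leRHS](subrK (t * h.2)) addrC lerD //.
  have -> : h.2 - t * h.2 = (1 - t) * h.2 by ring.
  by rewrite ler_wpM2l ?subr_ge0.
by rewrite ler_wpM2l.
Qed.

Lemma perm_actE (s : 'S_n) x j : perm_act s x 0 j = x 0 (s^-1%g j).
Proof.
rewrite /perm_act summxE (bigD1 (s^-1%g j)) //= big1 ?addr0 => [|i ij].
  by rewrite !mxE permKV !eqxx mulr1.
rewrite !mxE /=; case: eqP => [jE|]; last by rewrite mulr0.
by rewrite jE permK eqxx in ij.
Qed.

Lemma perm_actM (s s' : 'S_n) x : perm_act s' (perm_act s x) = perm_act (s * s')%g x.
Proof. by apply/rowP => j; rewrite !perm_actE invMg permM. Qed.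

Lemma perm_act1 x : perm_act 1 x = x.
Proof. by apply/rowP => j; rewrite perm_actE invg1 perm1. Qed.

Lemma perm_actD (s : 'S_n) x y : perm_act s (x + y) = perm_act s x + perm_act s y.
Proof. by apply/rowP => j; rewrite !(perm_actE, mxE). Qed.

Lemma perm_actZ (s : 'S_n) (t : R) x : perm_act s (t *: x) = t *: perm_act s x.
Proof. by apply/rowP => j; rewrite !(perm_actE, mxE). Qed.

Lemma dot_perm_act (s : 'S_n) a x : dot (perm_act s a) (perm_act s x) = dot a x.
Proof.
rewrite /dot (reindex_inj (@perm_inj _ s)); apply: eq_bigr => i _.
by rewrite !perm_actE permK.
Qed.

Lemma has_dim_inj A d e : has_dim A d -> has_dim A e -> d = e.
Proof.
move=> [_ [U [<- AU Umin]]] [_ [V [<- AV Vmin]]]; apply/eqP.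
by rewrite eqn_leq !dimvS //; [apply: Vmin | apply: Umin].
Qed.

End Hull.

(* [G] and [d] are dual bases up to sign: [P] lies in the simplicial cone with
   apex [v], facet inequalities [G] and generating rays [d], and every ray
   reaches a point of [V]. *)
Definition simplicial_cone (R : realType) n (P V : set 'rV[R]_n) v
    (G : 'I_n -> linear_ineq R n) (d : 'I_n -> 'rV[R]_n) : Prop :=
  [/\ V v,
      forall i, valid P (G i),
      forall i, dot (G i).1 v = (G i).2,
      forall i j, dot (G i).1 (d j) = - (i == j)%:R &
      forall i, exists2 t : R, 0 < t & V (v + t *: d i)].

(** * Optimality, faces, edges and facets at the apex of a cone *)

Section Cone.
Variables (R : realType) (n : nat) (P V : set 'rV[R]_n).
Hypothesis VP : V `<=` P.
Implicit Types (x y a : 'rV[R]_n) (h : linear_ineq R n).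

Section AtVertex.
Variables (v : 'rV[R]_n) (G : 'I_n -> linear_ineq R n) (d : 'I_n -> 'rV[R]_n).
Hypothesis cone : simplicial_cone P V v G d.

Let normals : 'M[R]_n := \matrix_i (G i).1.
Let dirs : 'M[R]_n := \matrix_i d i.

(** Duality makes [dirs^T] a right inverse of [- normals]; for square matrices it is also a left
    inverse, which is what expanding vectors in either basis requires. *)
Lemma normals_dirs : dirs^T *m normals = - 1%:M.
Proof.
case: cone => _ _ _ dual _.
have : - normals *m dirs^T = 1%:M.
  apply/matrixP => i j; rewrite mulNmx !mxE -[RHS]opprK -dual; congr (- _).
  by apply: eq_bigr => k _; rewrite !mxE.
by move/mulmx1C; rewrite mulmxN => /(canRL (@opprK _)).
Qed.

(** The coefficients are the slacks of the [G i], nonnegative on [P]: this is the containment of [P]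
    in the cone. *)
Lemma cone_coord x : x - v = \sum_i ((G i).2 - dot (G i).1 x) *: d i.
Proof.
have [_ _ tight _ _] := cone.
have nd : normals^T *m dirs = - 1%:M.
  by rewrite -[LHS]trmxK trmx_mul trmxK normals_dirs linearN /= trmx1.
rewrite -[LHS]mulmx1 -[1%:M]opprK -nd
  mulmxN mulmxA mulmx_sum_row -sumrN; apply: eq_bigr => i _.
rewrite rowK -scaleNr; congr (_ *: _).
have -> : (G i).2 - dot (G i).1 x = - dot (G i).1 (x - v) by rewrite dotBr tight opprB.
by congr (- _); rewrite mxE; apply: eq_bigr => j _; rewrite [RHS]mulrC !mxE.
Qed.

Lemma normal_coord a : a = \sum_i (- dot a (d i)) *: (G i).1.
Proof.
rewrite -[LHS]mulmx1 -[1%:M]opprK -normals_dirs mulmxN mulmxA mulmx_sum_row -sumrN.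
apply: eq_bigr => i _; rewrite rowK -scaleNr; congr (- _ *: _).
by rewrite mxE; apply: eq_bigr => j _; rewrite !mxE.
Qed.

Lemma dot_cone a x :
  dot a x = dot a v + \sum_i ((G i).2 - dot (G i).1 x) * dot a (d i).
Proof.
rewrite -[x in LHS](subrK v) [in LHS]cone_coord addrC dotDr dot_sumr; congr (_ + _).
by apply: eq_bigr => i _; rewrite dotZr.
Qed.

Lemma cone_slack_ge0 x i : P x -> 0 <= (G i).2 - dot (G i).1 x.
Proof. by have [_ Gv _ _ _] := cone; rewrite subr_ge0 => /Gv; exact. Qed.

(** The optimality test of the simplex method: by [dot_cone], the change from [v] to [x] is a sum of
    slacks times slopes along the rays. *)
Lemma cone_max a : (forall i, dot a (d i) <= 0) ->
  forall x, P x -> dot a x <= dot a v.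
Proof.
move=> ad x Px; rewrite dot_cone gerDl; apply: sumr_le0 => i _.
by rewrite mulr_ge0_le0 ?ad ?cone_slack_ge0.
Qed.

Lemma cone_vertex : vertices P v.
Proof.
have [Vv Gv tight dual _] := cone.
(* The sum of the normals drops at unit rate along every ray, so [v] is its only maximizer on
   [P]. *)
pose a : 'rV[R]_n := \sum_i (G i).1.
have ad i : dot a (d i) = -1.
  rewrite dotC dot_sumr (bigD1 i) //= big1 => [|j ji]; rewrite dotC dual.
    by rewrite eqxx addr0.
  by rewrite (negPf ji) oppr0.
exists (a, dot a v) => [x Px|]; first by apply: cone_max => // i; rewrite ad.
apply/seteqP; split => [x ->|x [Px]]; first by split => //; exact: VP.
rewrite /hyperplane/= => /eqP; rewrite dot_cone -subr_eq0 addrAC subrr add0r.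
under eq_bigr => i _ do rewrite ad mulrN1.
rewrite sumrN oppr_eq0 psumr_eq0 => [/allP y0|i _]; last exact: cone_slack_ge0.
apply/eqP; rewrite -subr_eq0 cone_coord big1 // => i _.
by rewrite (eqP (y0 i (mem_index_enum i))) scale0r.
Qed.

Section Face.
Variable h : linear_ineq R n.
Hypotheses (hP : valid P h) (hv : dot h.1 v = h.2).

Lemma dot_face_le0 i : dot h.1 (d i) <= 0.
Proof.
have [_ _ _ _ /(_ i)[t t0 /VP/hP]] := cone.
by rewrite /halfspace/= dotDr hv dotZr gerDl pmulr_rle0.
Qed.

(** Tightness of [h] at [x] says that a sum of nonpositive terms, slack times slope, is zero; hence
    each term vanishes. *)
Lemma face_coord x : P x ->
  hyperplane h x <-> forall i, dot h.1 (d i) != 0 -> dot (G i).1 x = (G i).2.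
Proof.
move=> Px; rewrite /hyperplane/= dot_cone hv; split=> [/eqP|y0].
  rewrite -subr_eq0 addrAC subrr add0r -oppr_eq0 -sumrN psumr_eq0 => [/allP y0 i hi|i _].
    have := y0 i (mem_index_enum i); rewrite oppr_eq0 mulf_eq0 (negPf hi) orbF.
    by rewrite subr_eq0 => /eqP.
  by rewrite oppr_ge0 mulr_ge0_le0 ?cone_slack_ge0 ?dot_face_le0.
rewrite big1 ?addr0 // => i _.
have [->|/y0->] := eqVneq (dot h.1 (d i)) 0; first by rewrite mulr0.
by rewrite subrr mul0r.
Qed.

Lemma face_ray i t : P (v + t *: d i) -> dot h.1 (d i) = 0 ->
  (P `&` hyperplane h) (v + t *: d i).
Proof. by move=> Pi hi; split => //; rewrite /hyperplane/= dotDr dotZr hi mulr0 addr0. Qed.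

(** The normal of [G i] pairs to zero with every other direction but not with [d i], so [d i] is
    outside their span. *)
Lemma dirs_free (s : seq 'I_n) : uniq s -> free [seq d i | i <- s].
Proof.
have [_ _ _ dual _] := cone.
elim: s => [|i s IHs] /=; first by rewrite nil_free.
case/andP => si /IHs fs; rewrite free_cons fs andbT; apply/negP => dis.
have := @coord_span _ _ _ (in_tuple [seq d i | i <- s]) _ dis.
move=> /(congr1 (dot (G i).1)); rewrite dual eqxx dot_sumr big1 => [/eqP|k _].
  by rewrite oppr_eq0 oner_eq0.
have kl : (k < size s)%N by have := ltn_ord k; rewrite [X in (_ < X)%N -> _]size_map.
rewrite dotZr (nth_map i) // dual; case: eqP => [iE|_]; last by rewrite oppr0 mulr0.
by rewrite iE mem_nth in si.
Qed.

(** The rays along which [h] stays tight generate the differences by [face_coord], and each of them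
    reaches a point of the face beyond [v], so none can be left out. *)
Lemma face_dim : has_dim (P `&` hyperplane h) #|[set i | dot h.1 (d i) == 0]%SET|.
Proof.
have [/VP Pv _ tight dual rays] := cone.
have Fv : (P `&` hyperplane h) v by [].
split; first by exists v.
set Z := [set i | _]%SET.
exists <<[seq d i | i <- enum Z]>>%VS; split.
- by have /eqP-> := dirs_free (enum_uniq Z); rewrite size_map -cardE.
- suff Fsub x : (P `&` hyperplane h) x -> x - v \in <<[seq d i | i <- enum Z]>>%VS.
    move=> x y /Fsub xv /Fsub yv.
    by rewrite -(subrK v x) -addrA -[v - y]opprB memvB.
  move=> [Px /(face_coord Px) hx]; rewrite cone_coord memv_suml // => i _.
  have [di|/hx->] := eqVneq (dot h.1 (d i)) 0.
    by rewrite memvZ // memv_span // map_f // mem_enum inE di.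
  by rewrite subrr scale0r mem0v.
- move=> U FU; apply/span_subvP => _ /mapP[i + ->]; rewrite mem_enum inE => /eqP di.
  have [t t0 /VP Pi] := rays i.
  have := FU _ _ (face_ray Pi di) Fv; rewrite addrAC subrr add0r => /(memvZ t^-1).
  by rewrite scalerA mulVf ?scale1r ?gt_eqF.
Qed.

End Face.

Lemma cone_dim : has_dim P n.
Proof.
have [Vv _ _ _ _] := cone.
(* The trivial inequality makes [P] a face of itself, and every direction is flat for it. *)
have v0 : valid P (0, 0) by move=> x _; rewrite /halfspace/= dot0l.
have := face_dim v0 (dot0l v).
have -> : P `&` hyperplane (0, 0) = P by apply/setIidl => x _; exact: dot0l.
suff -> : [set i | dot (0, 0 : R).1 (d i) == 0]%SET = [set: 'I_n]%SET by rewrite cardsT card_ord.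
by apply/setP => i; rewrite !inE dot0l eqxx.
Qed.

Lemma cone_facet i : facet_defining P (G i).
Proof.
have [Vv Gv tight dual _] := cone.
split; first exact: Gv.
split; first by exists (G i).
exists n.-1; have n0 : (0 < n)%N by apply: leq_ltn_trans (ltn_ord i).
rewrite prednK //; split; first exact: cone_dim.
have := face_dim (Gv i) (tight i).
suff -> : [set j | dot (G i).1 (d j) == 0]%SET = [set~ i]%SET.
  by rewrite cardsC1 card_ord.
by apply/setP => j; rewrite !inE dual oppr_eq0 pnatr_eq0 eqb0 eq_sym.
Qed.

(** A facet loses exactly one dimension, so [h] has nonzero slope along a single [d i]; expanding
    [h.1] in the normals leaves a multiple of that of [G i]. *)
Lemma facet_cone h : facet_defining P h -> dot h.1 v = h.2 ->
  exists i (c : R), 0 < c /\ h = (c *: (G i).1, c * (G i).2).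
Proof.
have [Vv Gv tight dual _] := cone.
move=> [hP [_ [e [/(has_dim_inj cone_dim) nE Fe]]]] hv.
have := has_dim_inj (face_dim hP hv) Fe.
set Z := [set _ | _]%SET => Ze.
have /eqP/cards1P[i iE] : #|~: Z|%SET = 1%N.
  by apply/eqP; rewrite -(eqn_add2l #|Z|) cardsC card_ord Ze nE addn1.
have Zi : dot h.1 (d i) != 0.
  by have := set11 i; rewrite -iE !inE.
have hE : h.1 = (- dot h.1 (d i)) *: (G i).1.
  rewrite [LHS]normal_coord (bigD1 i) //= big1 ?addr0 // => j ji.
  have : j \notin ~: Z by rewrite iE inE.
  by rewrite !inE negbK => /eqP->; rewrite oppr0 scale0r.
exists i, (- dot h.1 (d i)); split.
  by rewrite oppr_gt0 lt_neqAle Zi dot_face_le0.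
have hE2 : h.2 = (- dot h.1 (d i)) * (G i).2 by rewrite -hv {1}hE dotZl tight.
by rewrite [LHS]surjective_pairing hE2 -hE.
Qed.

(** The part of [P] on the line through [v] with direction [d i]. *)
Definition cone_edge i : set 'rV[R]_n :=
  P `&` [set x | forall j, j != i -> dot (G j).1 x = (G j).2].

Lemma cone_edgeP F : (edge P F /\ F v) <-> exists i, F = cone_edge i.
Proof.
have [Vv Gv tight dual rays] := cone.
split=> [[[[h hP FE] F1] Fv]|[i ->]].
  have hv : dot h.1 v = h.2 by move: Fv; rewrite FE => -[].
  have := face_dim hP hv; rewrite -FE => /has_dim_inj/(_ F1)/eqP/cards1P[i iE].
  have iP j : (j != i) = (dot h.1 (d j) != 0).
    by move/setP: iE => /(_ j); rewrite !inE => ->.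
  exists i; rewrite FE; apply/seteqP; split => x [Px].
    move/(face_coord hP hv Px) => hx; split => // j; rewrite iP => hj; exact: hx.
  move=> /= hx; split => //; apply/(face_coord hP hv Px) => j; rewrite -iP => hj; exact: hx.
(* This form is constant along [d i] and drops along every other ray, so it exposes
   [cone_edge i]. *)
pose a : 'rV[R]_n := \sum_(j | j != i) (G j).1.
have ad j : dot a (d j) = - (j != i)%:R.
  rewrite dotC dot_sumr; have [->|ji] := eqVneq j i.
    by rewrite big1 ?oppr0 // => k ki; rewrite dotC dual (negPf ki) oppr0.
  rewrite (bigD1 j) //= big1 => [|k /andP[_ kj]]; rewrite dotC dual.
    by rewrite eqxx addr0.
  by rewrite (negPf kj) oppr0.
have aP : valid P (a, dot a v).
  by move=> x Px; apply: cone_max => // j; rewrite ad oppr_le0.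
have aE : cone_edge i = P `&` hyperplane (a, dot a v).
  apply/seteqP; split => x [Px hx]; split => //.
    apply/(face_coord aP erefl Px) => j; rewrite ad oppr_eq0 pnatr_eq0 eqb0 negbK.
    by move=> /hx.
  move=> j ji; move/(face_coord aP erefl Px): hx; apply.
  by rewrite ad ji oppr_eq0 oner_eq0.
split; last by split=> [|j _]; [exact: VP | exact: tight].
split; first by exists (a, dot a v).
rewrite aE; have := face_dim aP erefl.
suff -> : [set j | dot (a, dot a v).1 (d j) == 0]%SET = [set i]%SET by rewrite cards1.
by apply/setP => j; rewrite !inE ad oppr_eq0 pnatr_eq0 eqb0 negbK.
Qed.

(** The edge [i] contains a point [v + t *: d i] with [t > 0], where [G i] is not tight; on every
    other edge [G i] is tight. *)
Lemma cone_edge_inj : injective cone_edge.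
Proof.
have [Vv Gv tight dual rays] := cone.
move=> i j ijE; have [t t0 /VP Pi] := rays i.
have : cone_edge i (v + t *: d i).
  split => // k ki; rewrite dotDr dotZr dual (negPf ki) oppr0 mulr0 addr0; exact: tight.
rewrite ijE => -[_ /= /(_ i)]; case: eqP => // _ /(_ isT).
rewrite dotDr dotZr dual eqxx tight mulrN1 => /eqP.
by rewrite -subr_eq0 addrAC subrr add0r oppr_eq0 gt_eqF.
Qed.

Lemma cone_edges_card : ([set F | edge P F /\ F v] #= `I_n)%card.
Proof.
have -> : [set F | edge P F /\ F v] = [set cone_edge i | i in [set: 'I_n]].
  apply/seteqP; split => F /=; first by move=> /cone_edgeP[i ->]; exists i.
  by move=> [i _ <-]; apply/cone_edgeP; exists i.
rewrite card_eq_sym; apply: (card_eq_trans card_II); rewrite card_eq_sym.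
by apply: inj_card_eq => i j _ _; exact: cone_edge_inj.
Qed.

End AtVertex.

End Cone.

(** * Partial sums and parking functions *)

(** The bound in [upper_ineq], as a function of the size of the index set alone. *)
Definition topsum n (b : n.-tuple nat) (m : nat) : nat :=
  (\sum_(n - m + 1 <= i < n.+1) psum b i)%N.

Section PartialSums.
Local Open Scope nat_scope.
Variables (n : nat) (b : n.-tuple nat).

Lemma psumS i : psum b i.+1 = psum b i + part b i.+1.
Proof. by rewrite /psum big_nat_recr. Qed.

Lemma psum1 : psum b 1 = part b 1.
Proof. by rewrite /psum big_nat1. Qed.

Lemma topsumS m : m < n -> topsum b m.+1 = topsum b m + psum b (n - m).
Proof.
move=> mn; rewrite /topsum addn1 -subSn // subSS big_ltn ?addn1 1?addnC //.
by rewrite ltnS leq_subr.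
Qed.

Lemma topsum0 : topsum b 0 = 0.
Proof. by rewrite /topsum subn0 addn1 big_geq. Qed.

Lemma topsumE m : topsum b m = \sum_(l < n | n - m <= l) psum b l.+1.
Proof. by rewrite /topsum addn1 big_add1 /= big_geq_mkord. Qed.

(** Passing from [m] to [m.+1] raises [minn j m] exactly for [j > m], and the parts [b_(n-j+1)] with
    [j > m] add up to [S_(n-m)]. *)
Lemma topsum_minn m : m <= n ->
  topsum b m = \sum_(1 <= j < n.+1) minn j m * part b (n - j + 1).
Proof.
elim: m => [_|m IHm mn]; first by rewrite topsum0 big1 // => j _; rewrite minn0.
rewrite topsumS // IHm ?(ltnW mn) //.
under [RHS]eq_bigr => j _.
  have -> : minn j m.+1 = minn j m + (m.+1 <= j) by lia.
  rewrite mulnDl mulnbl.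
  over.
rewrite big_split /= -big_mkcond /=; congr (_ + _).
rewrite -(@big_nat_widenl _ _ _ m.+1 1 n.+1 xpredT) // big_nat_rev /=
  -[m.+1]add1n big_addn /psum subSn ?(ltnW mn) //.
by apply: eq_big_nat => i ?; congr (part b _); lia.
Qed.

Lemma card_ord_geq m : m <= n -> #|[set l : 'I_n | n - m <= l]%SET| = m.
Proof.
move=> mn; rewrite -sum1_card.
under eq_bigl do rewrite inE.
by rewrite -(big_geq_mkord _ _ xpredT (fun=> 1)) sum_nat_const_nat muln1; lia.
Qed.

Hypothesis b_gt0 : forall i : 'I_n, 0 < tnth b i.

Lemma psum_ltn i j : i < j -> j <= n -> psum b i < psum b j.
Proof.
elim: j => // j IHj; rewrite ltnS leq_eqVlt psumS => /orP[/eqP->|ij] jn.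
  by have := b_gt0 (Ordinal jn); rewrite (tnth_nth 0) /part /=; lia.
by have := IHj ij (ltnW jn); lia.
Qed.

Lemma psum_leq i j : i <= j -> j <= n -> psum b i <= psum b j.
Proof. by rewrite leq_eqVlt => /orP[/eqP->|ij jn] //; exact/ltnW/psum_ltn. Qed.

Lemma psum_geq i : i <= n -> i <= psum b i.
Proof.
elim: i => // i IHi lt_in; apply: leq_ltn_trans (psum_ltn (ltnSn i) lt_in).
exact/IHi/ltnW.
Qed.

(** Exchange with the final segment [W] of the same size: [S_(n-|I|)] separates the terms of
    [I :\: W] from those of [W :\: I]. *)
Lemma sum_psum_le (I : {set 'I_n}) : \sum_(i in I) psum b i.+1 <= topsum b #|I|.
Proof.
have In : #|I| <= n by rewrite -[leqRHS]card_ord max_card.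
pose W := [set l : 'I_n | n - #|I| <= l]%SET.
have -> : topsum b #|I| = \sum_(i in W) psum b i.+1.
  by rewrite topsumE; apply: eq_bigl => l; rewrite inE.
rewrite (big_setID W) [leqRHS](big_setID I) /= finset.setIC leq_add2l.
have cE : #|I :\: W| = #|W :\: I|.
  by apply/eqP; rewrite -(eqn_add2l #|I :&: W|) cardsID finset.setIC cardsID card_ord_geq.
apply: (@leq_trans (\sum_(i in I :\: W) psum b (n - #|I|))).
  by apply: leq_sum => i; rewrite !inE => /andP[+ _]; rewrite -ltnNge => iW; apply: psum_leq; lia.
rewrite sum_nat_const cE -sum_nat_const.
by apply: leq_sum => i; rewrite !inE => /andP[_ iW]; apply: psum_leq; [lia|exact: ltn_ord].
Qed.

Lemma topsum_ub a k : a + k <= n -> topsum b (a + k) <= topsum b a + k * psum b (n - a).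
Proof.
elim: k => [|k IHk]; first by rewrite !addn0.
rewrite addnS => akn; rewrite topsumS // mulSn addnCA addnC.
by apply: leq_add; [apply: psum_leq; lia | apply: IHk; lia].
Qed.

Lemma topsum_lb a : a <= n -> a * (psum b (n - a)).+1 <= topsum b a.
Proof.
elim: a => // a IHa an; rewrite topsumS // mulSnr; have := IHa (ltnW an).
have -> : n - a = (n - a.+1).+1 by lia.
have := @psum_ltn (n - a.+1) (n - a.+1).+1; rewrite ltnSn; nia.
Qed.

Lemma topsum_addn a k : a + k <= n -> topsum b a + k <= topsum b (a + k).
Proof.
elim: k => [|k IHk]; first by rewrite !addn0.
rewrite !addnS => akn; rewrite topsumS // -addn1; apply: leq_add; first by apply: IHk; lia.
by apply: leq_trans (psum_geq _); lia.
Qed.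

(** Replaces sorting by a matching with the partial sums, a form visibly stable under permuting and
    lowering entries. *)
Lemma parking_functionP (beta : n.-tuple nat) :
  parking_function b beta <->
  (forall i, 0 < tnth beta i) /\
  exists p : 'S_n, forall i, tnth beta i <= psum b (p i).+1.
Proof.
split=> -[beta0 le_beta]; split=> //.
  have /tuple_permP[p pE] : perm_eq beta (sort_tuple leq beta) by rewrite perm_sym perm_sort.
  exists p => i; have -> : tnth beta i = tnth (sort_tuple leq beta) (p i).
    by rewrite (tnth_nth 0) pE -(tnth_nth 0) tnth_mktuple.
  by rewrite (tnth_nth 0); apply: (le_beta (p i).+1) => /=.
move=> [//|j] /= jn; have [p le_p] := le_beta.
rewrite leqNgt; apply/negP => gt_j.
have /tuple_permP[q qE] : perm_eq (sort_tuple leq beta) beta by rewrite perm_sort.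
(* Pigeonhole: [p] would inject the [n - j] largest entries into the [n - j - 1] positions after
   [j]. The double subtractions fit [card_ord_geq]. *)
have sub : [set (q * p)%g l | l in [set l : 'I_n | n - (n - j) <= l]]%SET
    \subset [set l : 'I_n | n - (n - j.+1) <= l]%SET.
  apply/fintype.subsetP => _ /imsetP[l + ->]; rewrite !inE permM => jl.
  have : nth 0 (sort leq beta) j <= tnth beta (q l).
    have -> : tnth beta (q l) = nth 0 (sort leq beta) l.
      by rewrite [sort _ _]qE -(tnth_nth 0 [tuple _ | _ < n]) tnth_mktuple.
    apply: (sorted_leq_nth leq_trans leqnn); rewrite ?inE ?size_sort ?size_tuple //.
      by apply: sort_sorted; exact: leq_total.
    lia.
  move=> /(leq_trans gt_j)/leq_trans/(_ (le_p _)) lt_j.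
  have -> : n - (n - j.+1) = j.+1 by lia.
  by rewrite -ltnS ltnNge; apply: contraL lt_j => lt_p; rewrite -leqNgt psum_leq.
have := subset_leq_card sub; rewrite card_imset; last exact: perm_inj.
by rewrite !card_ord_geq; lia.
Qed.

End PartialSums.

(** * The inequality description *)

Section Majorization.
Variables (R : realType) (n : nat) (P : set 'rV[R]_n).
Implicit Types x u : 'rV[R]_n.

Definition reset (i : 'I_n) x : 'rV[R]_n := \row_j if j == i then 1 else x 0 j.

Hypothesis P_convex :
  forall x y (t : R), P x -> P y -> 0 <= t <= 1 -> P (t *: x + (1 - t) *: y).
Hypothesis P_tperm : forall i j x, P x -> P (perm_act (tperm i j) x).
Hypothesis P_reset : forall i x, P x -> P (reset i x).

(** The new point divides the segment from [u] to its image under the transposition, at the fraction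
    [e / (u_j - u_k)]. *)
Lemma transfer_mem u (j k : 'I_n) (e : R) :
  P u -> u 0 k < u 0 j -> 0 <= e <= u 0 j - u 0 k ->
  P (u + e *: (delta_mx 0 k - delta_mx 0 j)).
Proof.
move=> Pu ukj /andP[e0 ele]; have d0 : 0 < u 0 j - u 0 k by rewrite subr_gt0.
have jk : j != k by apply: contraTneq ukj => ->; rewrite ltxx.
have t01 : 0 <= 1 - e / (u 0 j - u 0 k) <= 1.
  by rewrite subr_ge0 ler_pdivrMr // mul1r ele gerBl divr_ge0 // ltW.
have := P_convex Pu (P_tperm k j Pu) t01; congr P.
apply/rowP => i; rewrite !(mxE, perm_actE) tpermV eqxx /=.
case: tpermP => [->|->|/eqP/negPf-> /eqP/negPf->]; rewrite ?eqxx.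
- by rewrite eq_sym (negPf jk) /=; field; rewrite gt_eqF.
- by rewrite (negPf jk) /=; field; rewrite gt_eqF.
- by rewrite /=; ring.
Qed.

(** The new point is on the segment from [u] to [reset i u], which degenerates when [u_i = 1]. *)
Lemma lower_mem u i (c : R) : P u -> 1 <= c -> c <= u 0 i ->
  P (\row_j if j == i then c else u 0 j).
Proof.
move=> Pu c1 cu; have [u1|u1] := eqVneq (u 0 i) 1.
  have -> : \row_j (if j == i then c else u 0 j) = u => //.
  by apply/rowP => j; rewrite mxE; case: eqP => // ->; apply/le_anti; rewrite cu u1 c1.
have d0 : 0 < u 0 i - 1 by rewrite subr_gt0 lt_neqAle eq_sym u1 (le_trans c1).
have t01 : 0 <= (c - 1) / (u 0 i - 1) <= 1.
  by rewrite ler_pdivrMr // mul1r lerD2r cu divr_ge0 ?subr_ge0 // (le_trans c1).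
have := P_convex Pu (P_reset i Pu) t01; congr P.
apply/rowP => j; rewrite !mxE; case: eqP => [->|_]; last by ring.
by field; rewrite gt_eqF.
Qed.

(* The Hardy-Littlewood-Polya argument, by induction on the number of
   coordinates where [x] and [u] differ. If [k] is the last index with
   [x_k > u_k], some [j > k] has [u_j > x_j]; moving mass from [u_j] to [u_k]
   settles one of the two coordinates and stays in [P] because [u_j > u_k].
   When [x <= u], coordinates of [u] are lowered one at a time. *)
Lemma weak_majorization x u :
  (forall i, 1 <= x 0 i) -> (forall i j : 'I_n, (i <= j)%N -> x 0 i <= x 0 j) ->
  (forall k, \sum_(l < n | (k <= l)%N) x 0 l <= \sum_(l < n | (k <= l)%N) u 0 l) ->
  P u -> P x.
Proof.
move=> x1 x_mono.
have [m] := ubnP #|[set i | x 0 i != u 0 i]%SET|.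
elim: m u => // m IHm u le_m xu Pu.
(* Replacing [u] by a point that settles one coordinate and disturbs no settled one shrinks the set
   of disagreements. *)
have step (w : 'rV[R]_n) k : x 0 k != u 0 k -> w 0 k = x 0 k ->
    (forall i, x 0 i = u 0 i -> x 0 i = w 0 i) ->
    (forall k, \sum_(l < n | (k <= l)%N) x 0 l <= \sum_(l < n | (k <= l)%N) w 0 l) ->
    P w -> P x.
  move=> xuk wk wu xw Pw; apply: (IHm w) => //.
  rewrite -ltnS; apply: leq_trans le_m; rewrite ltnS; apply: proper_card.
  apply/fintype.properP; split.
    apply/fintype.subsetP => i; rewrite !inE; apply: contra => /eqP/wu ?; exact/eqP.
  by exists k; rewrite !inE ?wk ?eqxx.
have [/existsP[k0 xuk0]|/existsPn xu_le] := boolP [exists k, u 0 k < x 0 k].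
  case: (@arg_maxnP _ k0 (fun k => u 0 k < x 0 k) (@nat_of_ord n) xuk0) => k xuk k_max.
  have le_after (l : 'I_n) : (k < l)%N -> x 0 l <= u 0 l.
    by move=> kl; rewrite leNgt; apply/negP => /k_max /=; rewrite leqNgt kl.
  have [j kj xuj] : exists2 j : 'I_n, (k < j)%N & x 0 j < u 0 j.
    apply/exists_inP; apply: contraT => /exists_inPn no_j.
    have := xu k; rewrite leNgt => /negP[].
    rewrite [ltLHS](bigD1 k) // [ltRHS](bigD1 k) //=; apply: ltr_leD => //.
    apply: ler_sum => l /andP[kl lk]; rewrite leNgt.
    have {}kl : (k < l)%N by rewrite ltn_neqAle kl andbT eq_sym; exact: lk.
    exact: no_j kl.
  have xkj : x 0 k <= x 0 j by apply: x_mono; exact: ltnW.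
  pose e := Num.min (u 0 j - x 0 j) (x 0 k - u 0 k).
  have [e0 ej ek] : [/\ 0 < e, e <= u 0 j - x 0 j & e <= x 0 k - u 0 k].
    by rewrite lt_min !subr_gt0 xuj xuk !ge_min !lexx orbT.
  have jk : j != k by apply: contraTneq kj => ->; rewrite ltnn.
  pose w := u + e *: (delta_mx 0 k - delta_mx 0 j).
  have Pw : P w.
    apply: transfer_mem => //; first by lra.
    by apply/andP; split; lra.
  have wE i : w 0 i = u 0 i + e * ((i == k)%:R - (i == j)%:R) by rewrite !mxE eqxx.
  have wk : w 0 k = u 0 k + e by rewrite wE eqxx eq_sym (negPf jk) subr0 mulr1.
  have wj : w 0 j = u 0 j - e by rewrite wE eqxx (negPf jk) sub0r mulrN1.
  have wu (i : 'I_n) : x 0 i = u 0 i -> x 0 i = w 0 i.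
    move=> xui; rewrite wE; have [ik|_] := eqVneq i k; first by move: xuk; rewrite -ik xui ltxx.
    have [ij|_] := eqVneq i j; first by move: xuj; rewrite -ij xui ltxx.
    by rewrite subrr mulr0 addr0.
  (* Tails starting at or before [k] keep their sum; later ones are compared term by term, since
     [x <= u] after [k] and [w] stays above [x] at [j]. *)
  have xw i : \sum_(l < n | (i <= l)%N) x 0 l <= \sum_(l < n | (i <= l)%N) w 0 l.
    have [ik|ki] := leqP i k.
      apply: le_trans (xu i) _; under [leRHS]eq_bigr do rewrite wE.
      have ij : (i <= j)%N by apply: leq_trans (ltnW kj).
      rewrite big_split /= lerDl -mulr_sumr sumrB (bigD1 k) //= eqxx big1 ?addr0.
        rewrite (bigD1 j) //= eqxx big1 ?addr0 ?subrr ?mulr0 //.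
        by move=> l /andP[_ /negPf->].
      by move=> l /andP[_ /negPf->].
    have [ij|ji] := leqP i j.
      rewrite [leLHS](bigD1 j) // [leRHS](bigD1 j) //= wj lerD //; first by lra.
      apply: ler_sum => l /andP[il /negPf lj]; rewrite wE lj.
      have lk : (l == k) = false by apply/eqP => lk; move: il; rewrite lk leqNgt ki.
      by rewrite lk subrr mulr0 addr0 le_after // (leq_trans ki).
    apply: ler_sum => l il; rewrite wE.
    have lk : (l == k) = false by apply/eqP => lk; move: il; rewrite lk leqNgt ki.
    have lj : (l == j) = false by apply/eqP => lj; move: il; rewrite lj leqNgt ji.
    by rewrite lk lj subrr mulr0 addr0 le_after // (leq_trans ki).
  have [eE|eE] : e = u 0 j - x 0 j \/ e = x 0 k - u 0 k.
    by rewrite /e; case: leP; [left|right].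
  - by apply: (step w j) => //; [rewrite lt_eqF | rewrite wj eE; ring].
  - by apply: (step w k) => //; [rewrite gt_eqF | rewrite wk eE; ring].
have {}xu_le i : x 0 i <= u 0 i by rewrite leNgt.
have [/existsP[i xui]|/existsPn xu_eq] := boolP [exists i, x 0 i != u 0 i]; last first.
  suff -> : x = u by [].
  by apply/rowP => i; have := xu_eq i; rewrite negbK => /eqP.
apply: (step _ i xui _ _ _ (lower_mem Pu (x1 i) (xu_le i))); first by rewrite mxE eqxx.
  by move=> l xul; rewrite mxE; case: eqP => // ->.
by move=> l; apply: ler_sum => k _; rewrite mxE; case: eqP => [->|].
Qed.

End Majorization.

Lemma perm_sort_row (R : realType) n (x : 'rV[R]_n) :
  exists s : 'S_n, forall i j : 'I_n, (i <= j)%N ->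
    perm_act s x 0 i <= perm_act s x 0 j.
Proof.
pose t := [tuple x 0 i | i < n].
have /tuple_permP[q qE] : perm_eq (sort_tuple <=%R t) t by rewrite perm_sort.
exists q^-1%g => i j ij; rewrite !perm_actE invgK.
have tE k : x 0 (q k) = nth 0 (sort <=%R t) k.
  by rewrite [sort _ _]qE -(tnth_nth 0 [tuple _ | _ < n]) !tnth_mktuple.
rewrite !tE; apply: (sorted_leq_nth le_trans lexx) => //.
- by apply: sort_sorted; exact: le_total.
- by rewrite inE size_sort size_tuple.
- by rewrite inE size_sort size_tuple.
Qed.

(** * Symmetry of the parking polytope and validity and sufficiency of its inequalities *)

Section ParkingPolytope.
Variables (R : realType) (n : nat) (b : n.-tuple nat).
Hypothesis b_gt0 : forall i : 'I_n, (0 < tnth b i)%N.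
Implicit Types x : 'rV[R]_n.

Lemma parking_mem (c : 'I_n -> nat) (p : 'S_n) :
  (forall i, 0 < c i <= psum b (p i).+1)%N ->
  parking_polytope R b (\row_i (c i)%:R).
Proof.
move=> cp; apply: sub_convex_hull; exists [tuple c i | i < n].
  apply/(parking_functionP b_gt0); split=> [i|].
    by rewrite tnth_mktuple; have /andP[] := cp i.
  by exists p => i; rewrite tnth_mktuple; have /andP[] := cp i.
by apply/rowP => i; rewrite !mxE tnth_mktuple.
Qed.

Lemma parking_perm_act (s : 'S_n) x :
  parking_polytope R b x -> parking_polytope R b (perm_act s x).
Proof.
move: x; apply: convex_hull_min => [x y t Px Py t01|_ [beta pb <-]].
  by rewrite perm_actD !perm_actZ; exact: convex_hull_convex.
have /(parking_functionP b_gt0)[beta0 [p le_p]] := pb.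
have -> : perm_act s (\row_i (tnth beta i)%:R) = \row_i (tnth beta (s^-1%g i))%:R :> 'rV[R]_n.
  by apply/rowP => i; rewrite perm_actE !mxE.
by apply: (parking_mem (p := (s^-1 * p)%g)) => i; rewrite beta0 permM le_p.
Qed.

Lemma parking_reset i x : parking_polytope R b x -> parking_polytope R b (reset i x).
Proof.
move: x; apply: convex_hull_min => [x y t Px Py t01|_ [beta pb <-]].
  have -> : reset i (t *: x + (1 - t) *: y) = t *: reset i x + (1 - t) *: reset i y.
    by apply/rowP => j; rewrite !mxE; case: eqP => // _; ring.
  exact: convex_hull_convex.
have /(parking_functionP b_gt0)[beta0 [p le_p]] := pb.
have -> : reset i (\row_i (tnth beta i)%:R) =
    \row_j (if j == i then 1%N else tnth beta j)%:R :> 'rV[R]_n.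
  by apply/rowP => j; rewrite !mxE; case: eqP.
apply: (parking_mem (p := p)) => j; case: eqP => _; last by rewrite beta0 le_p.
by apply: leq_trans (psum_geq b_gt0 _).
Qed.

Lemma vk_mem k : parking_polytope R b (vk R b k).
Proof.
have -> : vk R b k = \row_i (if (i < k)%N then 1%N else psum b i.+1)%:R.
  by apply/rowP => i; rewrite !mxE; case: ifP.
apply: (parking_mem (p := 1%g)) => i; rewrite perm1.
have := psum_geq b_gt0 (ltn_ord i); case: ifP => _; lia.
Qed.

Lemma dot_lower i x : dot (lower_ineq R i).1 x = - x 0 i.
Proof. by rewrite /= dotC dotNr dot_delta. Qed.

Lemma dot_upper (I : {set 'I_n}) x : dot (upper_ineq R b I).1 x = \sum_(i in I) x 0 i.
Proof.
rewrite /dot [RHS]big_mkcond; apply: eq_bigr => i _; rewrite mxE.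
by case: (i \in I); rewrite ?mul1r ?mul0r.
Qed.

Lemma lower_halfspace i x : halfspace (lower_ineq R i) x <-> 1 <= x 0 i.
Proof. by rewrite -[1 <= _]lerN2 -dot_lower. Qed.

Lemma upper_halfspace (I : {set 'I_n}) x :
  halfspace (upper_ineq R b I) x <-> \sum_(i in I) x 0 i <= (topsum b #|I|)%:R.
Proof. by rewrite -dot_upper. Qed.

Lemma lower_valid i : valid (parking_polytope R b) (lower_ineq R i).
Proof.
apply: convex_hull_halfspace => _ [beta [beta0 _] <-].
by apply/lower_halfspace; rewrite mxE ler1n.
Qed.

(** The matching [p] bounds the entries over [I] by partial sums with distinct indices, so
    [sum_psum_le] applies to the image of [I]. *)
Lemma upper_valid (I : {set 'I_n}) :
  valid (parking_polytope R b) (upper_ineq R b I).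
Proof.
apply: convex_hull_halfspace => _ [beta /(parking_functionP b_gt0)[_ [p le_p]] <-].
apply/upper_halfspace; under eq_bigr do rewrite mxE.
rewrite -natr_sum ler_nat -(card_imset _ (@perm_inj _ p)).
apply: leq_trans (sum_psum_le b_gt0 _).
by rewrite big_imset /=; [apply: leq_sum | move=> ? ? _ _; exact: perm_inj].
Qed.

Hypotheses (n_gt0 : (0 < n)%N) (not_n1b1 : ~ (n = 1%N /\ part b 1 = 1%N)).

(* When [b_1 = 1], the bound for [#|I| = n - 1] is the sum of the bound for
   the whole index set and of the lower bound for the missing coordinate. *)
Lemma solutions_bounds x : solutions (parking_ineqs R b) x ->
  (forall i, 1 <= x 0 i) /\
  forall I : {set 'I_n}, \sum_(i in I) x 0 i <= (topsum b #|I|)%:R.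
Proof.
move=> sol; have x1 i : 1 <= x 0 i.
  by apply/lower_halfspace/sol; left; exists i.
have upper (I : {set 'I_n}) : (0 < #|I|)%N -> (part b 1 = 1%N -> #|I| <> n.-1) ->
    \sum_(i in I) x 0 i <= (topsum b #|I|)%:R.
  by move=> I0 I1; apply/upper_halfspace/sol; right; exists I.
split=> // I; have [/eqP|I0] := posnP #|I|.
  by rewrite cards_eq0 => /eqP->; rewrite big_set0 ler0n.
have [b1|b1] := eqVneq (part b 1) 1%N; last by apply: upper => // /eqP; rewrite (negPf b1).
have [cI|/eqP cI] := eqVneq #|I| n.-1; last exact: upper.
have n1 : n != 1%N by apply/eqP => n1; apply: not_n1b1.
have /eqP/cards1P[i iE] : #|~: I|%SET = 1%N by have := cardsC I; rewrite card_ord cI; lia.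
have := upper [set: 'I_n]%SET; rewrite cardsT card_ord => /(_ n_gt0).
have -> : \sum_(j in [set: 'I_n]%SET) x 0 j = \sum_(j in I) x 0 j + x 0 i.
  rewrite [LHS](bigID (mem I)) /=; congr (_ + _); first by apply: eq_bigl => j; rewrite inE.
  by rewrite (eq_bigl (mem [set i]%SET)) ?big_set1 // => j; rewrite -iE !inE.
have nE : n = n.-1.+1 by lia.
have -> : topsum b n = (topsum b #|I| + 1)%N.
  have n1E : (n - n.-1 = 1)%N by lia.
  have := @topsumS n b n.-1; rewrite prednK // leqnn n1E psum1 b1 cI; exact.
have nn : part b 1 = 1%N -> n <> n.-1 by lia.
by rewrite natrD => /(_ nn); have := x1 i; lra.
Qed.

Lemma parking_polytopeE : parking_polytope R b = solutions (parking_ineqs R b).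
Proof.
apply/seteqP; split => [x Px h [[i _ <-]|[I _ <-]]|x /solutions_bounds[x1 xI]].
- exact: lower_valid.
- exact: upper_valid.
(* By symmetry [x] may be sorted; it is then weakly majorized by [v_0 = (S_1, .., S_n)]. *)
have [s x_mono] := perm_sort_row x.
suff Psx : parking_polytope R b (perm_act s x).
  by have := parking_perm_act s^-1%g Psx; rewrite perm_actM mulgV perm_act1.
have Ptperm i j y := @parking_perm_act (tperm i j) y.
apply: (weak_majorization (@convex_hull_convex R n _) Ptperm parking_reset (u := vk R b 0)) => //.
- by move=> i; rewrite perm_actE.
- move=> k; wlog kn : k / (k <= n)%N => [wkn|].
    have [/wkn//|nk] := leqP k n; rewrite !big1 // => l kl; have := ltn_ord l; lia.
  have -> : \sum_(l < n | (k <= l)%N) vk R b 0 0 l = (topsum b (n - k))%:R.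
    by rewrite topsumE natr_sum subKn //; apply: eq_bigr => l _; rewrite mxE.
  (* A tail of the sorted point is the sum of [x] over an index set of size [n - k]. *)
  have := xI [set s^-1%g l | l in [set l : 'I_n | n - (n - k) <= l]%N]%SET.
  rewrite card_imset ?card_ord_geq ?leq_subr //; last exact: perm_inj.
  rewrite big_imset /=; last by move=> ? ? _ _; exact: perm_inj.
  apply: le_trans; rewrite subKn // le_eqVlt; apply/orP; left; apply/eqP.
  by apply: eq_big => [l|l _]; rewrite ?inE ?perm_actE.
- exact: vk_mem.
Qed.

End ParkingPolytope.

(** * The cones at the permutations of the v_k *)

(** List each set followed by its complement and match the two enumerations of [T] position by
    position. *)
Lemma exists_perm_imset (T : finType) (A B : {set T}) :
  #|A| = #|B| -> exists s : {perm T}, [set s x | x in A]%SET = B.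
Proof.
move=> cAB; pose e (C : {set T}) := enum C ++ enum (~: C)%SET.
have mem_e C x : x \in e C by rewrite mem_cat !mem_enum inE; case: (x \in C).
have uniq_e C : uniq (e C).
  rewrite cat_uniq !enum_uniq andbT /=; apply/hasPn => x.
  by rewrite !mem_enum inE.
have size_e C : size (e C) = #|T| by rewrite size_cat -!cardE cardsC.
pose f x := nth x (e B) (index x (e A)).
have f_lt x : (index x (e A) < size (e B))%N by rewrite size_e -(size_e A) index_mem.
have f_inj : injective f.
  move=> x y; rewrite /f (set_nth_default x y) // => /eqP; rewrite nth_uniq //.
  by move/eqP/(congr1 (nth x (e A))); rewrite !nth_index.
exists (perm f_inj); apply/eqP; rewrite eqEcard card_imset; last exact: perm_inj.
rewrite -cAB leqnn andbT; apply/fintype.subsetP => _ /imsetP[x xA ->].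
have iA : (index x (e A) < size (enum B))%N.
  by rewrite index_cat mem_enum xA -cardE -cAB cardE index_mem mem_enum.
by rewrite permE /f nth_cat iA -mem_enum mem_nth.
Qed.

Section PermCone.
Variables (R : realType) (n : nat) (P V : set 'rV[R]_n) (s : 'S_n).
Hypothesis P_perm : forall t x, P x -> P (perm_act t x).
Hypothesis V_perm : forall t x, V x -> V (perm_act t x).

Lemma simplicial_cone_perm v (G : 'I_n -> linear_ineq R n) d :
  simplicial_cone P V v G d ->
  simplicial_cone P V (perm_act s v) (fun i => (perm_act s (G i).1, (G i).2))
    (fun i => perm_act s (d i)).
Proof.
move=> [Vv Gv tight dual rays]; split=> [|i x|i|i j|i].
- exact: V_perm.
- move=> /(P_perm s^-1%g)/(Gv i); rewrite /halfspace/= -(dot_perm_act s (G i).1).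
  by rewrite perm_actM mulVg perm_act1.
- by rewrite dot_perm_act.
- by rewrite dot_perm_act.
- have [t t0 Vi] := rays i; exists t => //.
  by rewrite -perm_actZ -perm_actD; exact: V_perm.
Qed.

End PermCone.

Section Vertices.
Variables (R : realType) (n : nat) (b : n.-tuple nat).
Hypothesis b_gt0 : forall i : 'I_n, (0 < tnth b i)%N.
Hypotheses (n_gt0 : (0 < n)%N) (not_n1b1 : ~ (n = 1%N /\ part b 1 = 1%N)).
Implicit Types x : 'rV[R]_n.

Definition vk_perms : set 'rV[R]_n :=
  [set x | exists (s : {perm 'I_n}) (k : nat), (k <= n)%N /\ x = perm_act s (vk R b k)].

Let P := parking_polytope R b.
Let V := vk_perms.

Lemma vk_perms_perm_act (s : 'S_n) x : V x -> V (perm_act s x).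
Proof. by move=> [t [k [kn ->]]]; exists (t * s)%g, k; rewrite perm_actM. Qed.

Lemma vk_perms_vk k : (k <= n)%N -> V (vk R b k).
Proof. by move=> kn; exists 1%g, k; rewrite perm_act1. Qed.

Lemma vk_perms_sub : V `<=` P.
Proof. by move=> _ [s [k [kn ->]]]; apply: parking_perm_act => //; exact: vk_mem. Qed.

Lemma lower_perm_act (s : 'S_n) i :
  lower_ineq R (s i) = (perm_act s (lower_ineq R i).1, (lower_ineq R i).2).
Proof.
congr pair; apply/rowP => j; rewrite perm_actE !mxE /=.
by rewrite (canF_eq (permKV s)).
Qed.

Lemma upper_perm_act (s : 'S_n) (I : {set 'I_n}) :
  upper_ineq R b (s @: I) = (perm_act s (upper_ineq R b I).1, (upper_ineq R b I).2).
Proof.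
congr pair; last by rewrite /= card_imset //; exact: perm_inj.
apply/rowP => j; rewrite perm_actE !mxE /= -{1}(permKV s j) mem_imset //.
exact: perm_inj.
Qed.

Lemma parking_ineqs_perm_act (s : 'S_n) g :
  parking_ineqs R b g -> parking_ineqs R b (perm_act s g.1, g.2).
Proof.
move=> [[i _ <-]|[I [I0 I1] <-]].
  by rewrite -lower_perm_act; left; exists (s i).
rewrite -upper_perm_act; right; exists (s @: I)%SET => //.
by rewrite /= card_imset //; exact: perm_inj.
Qed.

(** The preceding index; the truncation at 0 is harmless, as directions use it only at positive
    indices. *)
Definition lower_dir (i : 'I_n) : 'I_n := Ordinal (leq_ltn_trans (leq_pred i) (ltn_ord i)).

Definition final_segment (i : 'I_n) : {set 'I_n} := [set l : 'I_n | i <= l]%N%SET.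

Lemma card_final_segment i : #|final_segment i| = (n - i)%N.
Proof.
rewrite -(@card_ord_geq n (n - i)) ?leq_subr // subKn //.
exact/ltnW/ltn_ord.
Qed.

Lemma final_segment_tight (i : 'I_n) k : (k <= i)%N ->
  dot (upper_ineq R b (final_segment i)).1 (vk R b k) = (upper_ineq R b (final_segment i)).2.
Proof.
move=> ki; rewrite dot_upper /= -/(topsum b #|final_segment i|) card_final_segment topsumE.
rewrite subKn 1?ltnW ?ltn_ord // natr_sum; apply: eq_big => [l|l]; rewrite inE // => il.
by rewrite mxE ltnNge (leq_trans ki il).
Qed.

Lemma dot_lower_delta (i j : 'I_n) : dot (lower_ineq R i).1 (delta_mx 0 j) = - (i == j)%:R.
Proof. by rewrite dot_lower mxE. Qed.

Lemma dot_upper_delta (I : {set 'I_n}) j :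
  dot (upper_ineq R b I).1 (delta_mx 0 j) = (j \in I)%:R.
Proof. by rewrite dot_delta mxE. Qed.

Lemma natr_boolB (p q r : bool) : (p + r = q)%N -> p%:R - q%:R = - r%:R :> R.
Proof. by move=> <-; rewrite natrD opprD addrA subrr sub0r. Qed.

Definition vk_ineq (k : nat) (i : 'I_n) : linear_ineq R n :=
  if (i < k)%N then lower_ineq R i else upper_ineq R b (final_segment i).

(** In order: raise one of the 1s, lower [S_(k+1)] towards 1, move mass from a later partial sum to
    the preceding one. *)
Definition vk_dir (k : nat) (i : 'I_n) : 'rV[R]_n :=
  if (i < k)%N then delta_mx 0 i
  else if i == k :> nat then - delta_mx 0 i
  else delta_mx 0 (lower_dir i) - delta_mx 0 i.

Lemma vk_swap k (i : 'I_n) : (k < i)%N ->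
  vk R b k + ((psum b i.+1)%:R - (psum b i)%:R) *: (delta_mx 0 (lower_dir i) - delta_mx 0 i) =
  perm_act (tperm (lower_dir i) i) (vk R b k).
Proof.
move=> ki; have i0 : (0 < i)%N by apply: leq_ltn_trans ki.
apply/rowP => l; rewrite perm_actE tpermV !mxE eqxx /=.
have pi : (lower_dir i < k)%N = false by rewrite /= ltnNge -ltnS prednK // ki.
have ik : (i < k)%N = false by rewrite ltnNge ltnW.
have pi_neq : lower_dir i != i by rewrite -val_eqE /=; lia.
case: tpermP => [->|->|/eqP/negPf-> /eqP/negPf->].
- by rewrite eqxx (negPf pi_neq) pi ik /= prednK //; ring.
- by rewrite eqxx eq_sym (negPf pi_neq) pi ik /= prednK //; ring.
- by rewrite subrr mulr0 addr0.
Qed.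

Lemma vk_simplicial_cone k : (k <= n)%N -> (part b 1 = 1 -> 1 < k)%N ->
  simplicial_cone P V (vk R b k) (vk_ineq k) (vk_dir k).
Proof.
move=> kn k_gt1.
(* This gives the first two kinds of rays positive length. It would fail for [S_1] when [b_1 = 1],
   the case excluded by [k_gt1]. *)
have psum_gt1 i : (0 < i -> k <= i -> i <= n -> 1 < psum b i)%N.
  move=> i0 ki i_n; have [/k_gt1 k1|b1] := eqVneq (part b 1) 1%N.
    by apply: leq_trans (psum_geq b_gt0 i_n); lia.
  have := psum_leq b_gt0 i0 i_n; have := psum_geq b_gt0 n_gt0; rewrite psum1.
  by have := psum_ltn b_gt0 (ltnSn 0) n_gt0; rewrite psum1; lia.
split=> [|i|i|i j|i].
- exact: vk_perms_vk.
- by rewrite /vk_ineq; case: ifP => _; [exact: lower_valid | exact: upper_valid].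
- rewrite /vk_ineq; case: ltnP => [ik|ki]; last exact: final_segment_tight.
  by rewrite dot_lower mxE ik.
- rewrite /vk_ineq /vk_dir; case: (ltnP i k) => [ik|ki].
    case: (ltnP j k) => [jk|kj]; first by rewrite dot_lower_delta.
    case: eqP => jk.
      have -> : (i == j) = false by rewrite -val_eqE /=; lia.
      by rewrite dotNr dot_lower_delta -val_eqE /= jk ltn_eqF // !oppr0.
    rewrite dotBr !dot_lower_delta -!val_eqE /=.
    have -> : (i == j.-1 :> nat) = false by lia.
    have -> : (i == j :> nat) = false by lia.
    by rewrite !oppr0 addr0.
  case: (ltnP j k) => [jk|kj].
    rewrite dot_upper_delta inE -val_eqE /=.
    have -> : (i <= j)%N = false by lia.
    have -> : (i == j :> nat) = false by lia.
    by rewrite oppr0.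
  case: eqP => jk.
    by rewrite dotNr dot_upper_delta inE -val_eqE /=; congr (- (nat_of_bool _)%:R); lia.
  rewrite dotBr !dot_upper_delta !inE -val_eqE /=; apply: natr_boolB; lia.
- rewrite /vk_dir; case: (ltnP i k) => [ik|ki].
    (* Raising this 1 to [S_k] yields [v_(k-1)] up to swapping the positions [i] and [k - 1]. *)
    exists ((psum b k)%:R - 1); first by rewrite subr_gt0 ltr1n psum_gt1 //; lia.
    have k0 : (k.-1 < n)%N by lia.
    have [k' k'E] : exists k' : 'I_n, k' = k.-1 :> nat by exists (Ordinal k0).
    have -> : vk R b k + ((psum b k)%:R - 1) *: delta_mx 0 i =
        perm_act (tperm i k') (vk R b k.-1).
      apply/rowP => l; rewrite perm_actE tpermV !mxE eqxx /=.
      case: tpermP => [->|->|/eqP li /eqP lk].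
      + rewrite eqxx ik k'E ltnn prednK ?mulr1; last by lia.
        by ring.
      + rewrite -val_eqE /= k'E.
        have -> : (k.-1 < k)%N by lia.
        case: eqP => [ki|ki].
          by rewrite -ki ltnn prednK ?mulr1; [ring | lia].
        have -> : (i < k.-1)%N by lia.
        by rewrite mulr0 addr0.
      + rewrite (negPf li) mulr0 addr0.
        move: lk; rewrite -val_eqE /= k'E => lk.
        by have -> : (l < k.-1)%N = (l < k)%N by lia.
    by apply: vk_perms_perm_act; apply: vk_perms_vk; lia.
  case: eqP => ik.
    exists ((psum b i.+1)%:R - 1); first by rewrite subr_gt0 ltr1n psum_gt1 // -ik; lia.
    have -> : vk R b k + ((psum b i.+1)%:R - 1) *: - delta_mx 0 i = vk R b k.+1.
      apply/rowP => l; rewrite !mxE eqxx /= ltnS -ik -val_eqE /=.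
      by case: ltngtP => [||->]; rewrite ?mulr0 ?oppr0 ?mulr0 ?addr0 // mulrN mulr1; ring.
    by apply: vk_perms_vk; rewrite -ik.
  exists ((psum b i.+1)%:R - (psum b i)%:R).
    by rewrite subr_gt0 ltr_nat psum_ltn.
  rewrite vk_swap; first by apply: vk_perms_perm_act; exact: vk_perms_vk.
  lia.
Qed.

(* If [b_1 = 1], then [v_0 = v_1] and the bound for [{2, .., n}] is not in the
   list; the bound for the whole index set takes its place at [v_0]. *)
Definition v0_ineq (i : 'I_n) : linear_ineq R n :=
  if i == 0%N :> nat then lower_ineq R i
  else if i == 1%N :> nat then upper_ineq R b [set: 'I_n]%SET
  else upper_ineq R b (final_segment i).

(** With [i1] of value 1, index 0 swaps [S_1 = 1] and [S_2], and index 1 lowers [S_2] to 1, reaching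
    [v_2]. The parameter [i1] exists only for [n > 1]. *)
Definition v0_dir (i1 i : 'I_n) : 'rV[R]_n :=
  if i == 0%N :> nat then delta_mx 0 i - delta_mx 0 i1
  else if i == 1%N :> nat then - delta_mx 0 i
  else delta_mx 0 (lower_dir i) - delta_mx 0 i.

Lemma v0_simplicial_cone (i1 : 'I_n) : i1 = 1%N :> nat -> part b 1 = 1%N ->
  simplicial_cone P V (vk R b 0) v0_ineq (v0_dir i1).
Proof.
move=> i1E b1; have n1 : (1 < n)%N by rewrite -i1E.
split=> [|i|i|i j|i].
- exact: vk_perms_vk.
- rewrite /v0_ineq; case: eqP => _; first exact: lower_valid.
  by case: eqP => _; exact: upper_valid.
- rewrite /v0_ineq; case: eqP => i0; first by rewrite dot_lower mxE i0 psum1 b1.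
  case: eqP => _; last exact: final_segment_tight.
  have -> : [set: 'I_n]%SET = final_segment (Ordinal n_gt0) by apply/setP => l; rewrite !inE.
  exact: final_segment_tight.
- rewrite /v0_ineq /v0_dir; case: (eqVneq (i : nat) 0%N) => i0.
    have [j0|j0] := eqVneq (j : nat) 0%N.
      by rewrite dotBr !dot_lower_delta -!val_eqE /= i0 j0 i1E oppr0 subr0.
    have [j1|j1] := eqVneq (j : nat) 1%N.
      by rewrite dotNr !dot_lower_delta -!val_eqE /= i0 j1 !oppr0.
    rewrite dotBr !dot_lower_delta -!val_eqE /= i0.
    have -> : (0 == j.-1)%N = false by lia.
    have -> : (0 == j)%N = false by lia.
    by rewrite !oppr0 addr0.
  have [I1|I1] := eqVneq (i : nat) 1%N.
    have [j0|j0] := eqVneq (j : nat) 0%N.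
      by rewrite dotBr !dot_upper_delta !inE -!val_eqE /= I1 j0 subrr oppr0.
    have [j1|j1] := eqVneq (j : nat) 1%N.
      by rewrite dotNr !dot_upper_delta !inE -!val_eqE /= I1 j1.
    rewrite dotBr !dot_upper_delta !inE -!val_eqE /= I1 subrr.
    have -> : (1 == j)%N = false by lia.
    by rewrite oppr0.
  have [j0|j0] := eqVneq (j : nat) 0%N.
    rewrite dotBr !dot_upper_delta !inE -!val_eqE /= j0 i1E; apply: natr_boolB; lia.
  have [j1|j1] := eqVneq (j : nat) 1%N.
    by rewrite dotNr !dot_upper_delta !inE -!val_eqE /= j1; congr (- (nat_of_bool _)%:R); lia.
  by rewrite dotBr !dot_upper_delta !inE -!val_eqE /=; apply: natr_boolB; lia.
- rewrite /v0_dir; have [i0|i0] := eqVneq (i : nat) 0%N.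
    exists ((psum b i1.+1)%:R - (psum b i1)%:R); first by rewrite subr_gt0 ltr_nat psum_ltn.
    have -> : i = lower_dir i1 by apply: val_inj; rewrite /= i0 i1E.
    rewrite vk_swap ?i1E //; apply: vk_perms_perm_act; exact: vk_perms_vk.
  have [I1|I1] := eqVneq (i : nat) 1%N.
    exists ((psum b 2)%:R - 1).
      rewrite subr_gt0 ltr1n; apply: leq_ltn_trans (psum_ltn b_gt0 (ltnSn 1) n1).
      by rewrite psum1 b1.
    have -> : vk R b 0 + ((psum b 2)%:R - 1) *: - delta_mx 0 i = vk R b 2.
      apply/rowP => l; rewrite !mxE eqxx /= -val_eqE /= I1.
      case: (nat_of_ord l) => [|[|l']] //=.
      - by rewrite psum1 b1 oppr0 mulr0 addr0.
      - by ring.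
      - by rewrite oppr0 mulr0 addr0.
    exact: vk_perms_vk.
  exists ((psum b i.+1)%:R - (psum b i)%:R); first by rewrite subr_gt0 ltr_nat psum_ltn.
  rewrite vk_swap; first by apply: vk_perms_perm_act; exact: vk_perms_vk.
  lia.
Qed.

Lemma vk_perms_cone v : V v -> exists G d,
  simplicial_cone P V v G d /\ forall i, parking_ineqs R b (G i).
Proof.
move=> [s [k [kn ->]]].
suff [G [d [cone Gp]]] : exists G d,
    simplicial_cone P V (vk R b k) G d /\ forall i, parking_ineqs R b (G i).
  exists (fun i => (perm_act s (G i).1, (G i).2)), (fun i => perm_act s (d i)).
  split=> [|i]; last exact: parking_ineqs_perm_act.
  apply: simplicial_cone_perm => //.
    by move=> t x; exact: parking_perm_act.
  by move=> t x; exact: vk_perms_perm_act.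
(* The generic cone serves unless [b_1 = 1] and [k <= 1]; there [v_0 = v_1] and the modified cone
   takes over. *)
have [k1|k_le1] := boolP ((part b 1 == 1) ==> (1 < k))%N.
  have {}k1 : (part b 1 = 1 -> 1 < k)%N by move=> /eqP b1; move: k1; rewrite b1.
  exists (vk_ineq k), (vk_dir k); split; first exact: vk_simplicial_cone.
  move=> i; rewrite /vk_ineq; case: ltnP => ik; first by left; exists i.
  right; exists (final_segment i) => //; rewrite /= card_final_segment.
  by split=> [|/k1]; have := ltn_ord i; lia.
move: k_le1; rewrite negb_imply -leqNgt => /andP[/eqP b1 k1].
have n1 : (1 < n)%N by rewrite ltn_neqAle n_gt0 andbT eq_sym; apply/eqP => nE; exact: not_n1b1.
have -> : vk R b k = vk R b 0.
  apply/rowP => l; rewrite !mxE /=; case: ltnP => // lk.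
  have -> : (l : nat) = 0%N by lia.
  by rewrite psum1 b1.
exists v0_ineq, (v0_dir (Ordinal n1)); split; first exact: v0_simplicial_cone.
move=> i; rewrite /v0_ineq; case: eqP => i0; first by left; exists i.
right; case: eqP => i1; [exists [set: 'I_n]%SET | exists (final_segment i)] => //.
  by rewrite /= cardsT card_ord; split=> //; lia.
by rewrite /= card_final_segment; split=> [|_]; have := ltn_ord i; lia.
Qed.

(** With [cone_facet], this makes every listed inequality facet-defining. All lower bounds occur at
    [v_n]; an upper bound may be moved by a permutation to a final segment. *)
Lemma parking_ineqs_cone g : parking_ineqs R b g -> exists v G d i,
  simplicial_cone P V v G d /\ G i = g.
Proof.
have n1 : (part b 1 = 1 -> 1 < n)%N.
  by move=> b1; rewrite ltn_neqAle n_gt0 andbT eq_sym; apply/eqP => nE; exact: not_n1b1.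
move=> [[i _ <-]|[I [I0 I1] <-]].
  exists (vk R b n), (vk_ineq n), (vk_dir n), i; split; first exact: vk_simplicial_cone.
  by rewrite /vk_ineq ltn_ord.
have In : (#|I| <= n)%N by rewrite -[leqRHS]card_ord max_card.
have [i iE] : exists i : 'I_n, i = (n - #|I|)%N :> nat.
  have i_lt : (n - #|I| < n)%N by lia.
  by exists (Ordinal i_lt).
have segment_cone : exists v G d j,
    simplicial_cone P V v G d /\ G j = upper_ineq R b (final_segment i).
  have [b1|b1] := eqVneq (part b 1) 1%N; last first.
    exists (vk R b 0), (vk_ineq 0), (vk_dir 0), i; split=> //.
    by apply: vk_simplicial_cone => // /eqP; rewrite (negPf b1).
  have [nI|nI] := eqVneq #|I| n.
    exists (vk R b 0), v0_ineq, (v0_dir (Ordinal (n1 b1))), (Ordinal (n1 b1)).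
    split; first exact: v0_simplicial_cone.
    by congr upper_ineq; apply/setP => l; rewrite !inE iE nI subnn.
  (* Here [|I|] is neither [n] nor [n - 1], so the segment belongs to the generic cone at [v_2]. *)
  have i2 : (2 <= i)%N by have := I1 b1; rewrite iE; lia.
  exists (vk R b 2), (vk_ineq 2), (vk_dir 2), i; split.
    by apply: vk_simplicial_cone => //; have := n1 b1.
  by rewrite /vk_ineq ltnNge i2.
have [v [G [d [j [cone Gj]]]]] := segment_cone.
have [s sE] : exists s : 'S_n, [set s x | x in final_segment i]%SET = I.
  by apply: exists_perm_imset; rewrite card_final_segment iE subKn.
exists (perm_act s v), (fun i => (perm_act s (G i).1, (G i).2)), (fun i => perm_act s (d i)), j.
split; last by rewrite Gj -upper_perm_act sE.
apply: simplicial_cone_perm => //.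
  by move=> t x; exact: parking_perm_act.
by move=> t x; exact: vk_perms_perm_act.
Qed.

End Vertices.
Arguments vk_perms R {n} b _.

(** * Vertices, irredundancy and facets *)

Section Conclusion.
Variables (R : realType) (n : nat) (b : n.-tuple nat).
Hypothesis b_gt0 : forall i : 'I_n, (0 < tnth b i)%N.
Hypotheses (n_gt0 : (0 < n)%N) (not_n1b1 : ~ (n = 1%N /\ part b 1 = 1%N)).
Implicit Types (x : 'rV[R]_n) (h : linear_ineq R n).

Let P := parking_polytope R b.
Let V := vk_perms R b.

(* A maximizer over the finite set [V] is a maximizer over [P], because no
   ray of its simplicial cone increases the linear form. *)
Lemma face_vk_perms h : valid P h -> (P `&` hyperplane h) !=set0 ->
  exists2 v, V v & dot h.1 v = h.2.
Proof.
move=> hP [x [Px hx]].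
pose F (u : {perm 'I_n} * 'I_n.+1) := dot h.1 (perm_act u.1 (vk R b u.2)).
case: (@Order.TotalTheory.arg_maxP _ _ _ (1%g, ord0) xpredT F isT) => -[s k] _ max_sk.
have Vsk : V (perm_act s (vk R b k)) by exists s, k; rewrite -ltnS.
exists (perm_act s (vk R b k)) => //.
have [G [d [cone _]]] := vk_perms_cone b_gt0 n_gt0 not_n1b1 Vsk.
have [_ _ _ _ rays] := cone.
apply/le_anti/andP; split; first by apply: hP; exact: (vk_perms_sub b_gt0).
rewrite -[h.2]hx; apply: (cone_max cone) => // i.
have [t t0 [s' [k' [k'n vE]]]] := rays i.
have := max_sk (s', inord k') isT; rewrite /F /= inordK // -vE dotDr dotZr.
by rewrite gerDl pmulr_rle0.
Qed.

(** A vertex is a nonempty face, so [face_vk_perms] finds a point of [V] in it; conversely, the cone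
    at a point of [V] exposes it. *)
Lemma vertices_parking : vertices P = V.
Proof.
apply/seteqP; split => [v [h hP vE]|v Vv].
  have [|w Vw hw] := face_vk_perms hP; first by exists v; rewrite -vE.
  have : [set v] w by rewrite vE; split=> //; exact: (vk_perms_sub b_gt0).
  by move=> <-.
have [G [d [cone _]]] := vk_perms_cone b_gt0 n_gt0 not_n1b1 Vv.
exact: (cone_vertex (@vk_perms_sub R n b b_gt0) cone).
Qed.

(** * Irredundancy of the inequalities and classification of the facets *)

Lemma lower_irredundant (i : 'I_n) : exists x, ~ halfspace (lower_ineq R i) x /\
  forall h, parking_ineqs R b h -> h <> lower_ineq R i -> halfspace h x.
Proof.
exists (\row_j (j != i)%:R); split=> [/lower_halfspace|h].
  by rewrite mxE eqxx ler10.
move=> [[j _ <-] ji|[I _ <-] _].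
  by apply/lower_halfspace; rewrite mxE; case: eqP => // jiE; rewrite jiE in ji.
apply/upper_halfspace; apply: (@le_trans _ _ #|I|%:R).
  rewrite -sum1_card natr_sum; apply: ler_sum => j _.
  by rewrite mxE ler_nat leq_b1.
have In : (#|I| <= n)%N by rewrite -[leqRHS]card_ord max_card.
by rewrite ler_nat; have := @topsum_addn n b b_gt0 0 #|I| In; rewrite topsum0.
Qed.

(** The first [a] terms of [topsum b m] exceed [S_(n-a)] and the others do not, so their mean is
    larger; the extra unit is the excess of the witness in [upper_irredundant]. *)
Lemma topsum_average a m : (a < m <= n)%N ->
  (a * (topsum b m).+1 <= m * topsum b a)%N.
Proof.
move=> /andP[am mn].
have := @topsum_ub n b b_gt0 a (m - a); rewrite subnKC ?(ltnW am) // => /(_ mn).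
have := @topsum_lb n b b_gt0 a (leq_trans (ltnW am) mn).
have [k ->] : exists k, m = (a + k.+1)%N by exists (m - a).-1; lia.
rewrite addKn; nia.
Qed.

(** The first added term [S_(n-m)] exceeds 1 and the others are at least 1; the excluded case is
    [S_(n-m) = S_1 = 1]. *)
Lemma topsum_gt m c : (0 < c)%N -> (m + c <= n)%N -> (part b 1 = 1 -> m <> n.-1)%N ->
  (topsum b m + c < topsum b (m + c))%N.
Proof.
move=> c0 mcn m1; have mn : (m < n)%N by lia.
have := @topsum_addn n b b_gt0 m.+1 c.-1; rewrite topsumS //.
have -> : (m.+1 + c.-1 = m + c)%N by lia.
move=> /(_ mcn); suff : (1 < psum b (n - m))%N by lia.
have [b1|b1] := eqVneq (part b 1) 1%N.
  have := m1 b1 => m_neq; apply: leq_trans (psum_geq b_gt0 _); lia.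
have m_psum : (psum b 1 <= psum b (n - m))%N by apply: psum_leq => //; lia.
by have := psum_geq b_gt0 n_gt0; move: m_psum; rewrite psum1; lia.
Qed.

Lemma upper_irredundant (I : {set 'I_n}) :
  (0 < #|I|)%N -> (part b 1 = 1 -> #|I| <> n.-1)%N ->
  exists x, ~ halfspace (upper_ineq R b I) x /\
  forall h, parking_ineqs R b h -> h <> upper_ineq R b I -> halfspace h x.
Proof.
move=> I0 I1; set m := #|I|.
have mn : (m <= n)%N by rewrite -[leqRHS]card_ord max_card.
have m0 : 0 < m%:R :> R by rewrite ltr0n.
(* Taking this value on [I] makes the sum over [I] exceed its bound by exactly one. *)
pose c : R := (topsum b m).+1%:R / m%:R.
have cm : c *+ m = (topsum b m).+1%:R.
  by rewrite -[LHS]mulr_natr /c mulfVK // gt_eqF.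
exists (\row_j if j \in I then c else 1); split.
  move/upper_halfspace; rewrite (eq_bigr (fun=> c)) => [|j jI]; last by rewrite mxE jI.
  by rewrite sumr_const cm ler_nat ltnn.
move=> h [[j _ <-] _|[J _ <-] JI].
  apply/lower_halfspace; rewrite mxE; case: ifP => // _.
  rewrite ler_pdivlMr // mul1r ler_nat; apply: leqW.
  by have := @topsum_addn n b b_gt0 0 m mn; rewrite topsum0.
apply/upper_halfspace.
rewrite (big_setID I) /= (eq_bigr (fun=> c)) => [|j]; last by rewrite inE mxE => /andP[_ ->].
rewrite [X in _ + X](eq_bigr (fun=> 1)) => [|j]; last by rewrite inE mxE => /andP[/negPf->].
rewrite !sumr_const -(cardsID I J).
have aIJ : (#|J :&: I| + #|J :\: I| <= n)%N by rewrite cardsID -[leqRHS]card_ord max_card.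
(* A set properly containing [I] absorbs the excess by [topsum_gt]; otherwise the common part is
   smaller than [I] and [topsum_average] bounds its sum. *)
have [a_eq|a_lt] : #|J :&: I| = m \/ (#|J :&: I| < m)%N.
- by have := subset_leq_card (finset.subsetIr J I); rewrite leq_eqVlt => /orP[/eqP|]; [left|right].
- have IJ : I \subset J.
    apply/finset.setIidPr/eqP; rewrite eqEcard finset.subsetIr /=; exact: eq_leq.
  rewrite a_eq cm -natrD ler_nat addSn; apply: topsum_gt => //; last by rewrite -a_eq.
  rewrite card_gt0 finset.setD_eq0; apply/negP => JI'; apply: JI; congr upper_ineq.
  by apply/eqP; rewrite finset.eqEsubset JI'.
- apply: (@le_trans _ _ (topsum b #|J :&: I| + #|J :\: I|)%:R); last first.
    by rewrite ler_nat topsum_addn.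
  rewrite natrD lerD2r -[leLHS]mulr_natr /c mulrAC ler_pdivrMr // -!natrM ler_nat.
  by rewrite mulnC [leqRHS]mulnC topsum_average // a_lt mn.
Qed.

Lemma parking_minimal : minimal_description P (parking_ineqs R b).
Proof.
have PE : P = solutions (parking_ineqs R b) by exact: parking_polytopeE.
split=> // h hL sol.
have [x [hx xL]] : exists x, ~ halfspace h x /\
    forall g, parking_ineqs R b g -> g <> h -> halfspace g x.
  case: hL => [[i _ <-]|[I [I0 I1] <-]]; first exact: lower_irredundant.
  exact: upper_irredundant.
apply: hx; have : P x by rewrite -sol => g [gL gh]; apply: xL.
by rewrite PE; apply.
Qed.

(** A facet is nonempty, so it contains a point of [V], where [facet_cone] identifies [h];
    conversely, positive rescaling changes neither half-space nor hyperplane. *)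
Lemma facet_definingP h : facet_defining P h <->
  exists (c : R) g, [/\ 0 < c, parking_ineqs R b g & h = (c *: g.1, c * g.2)].
Proof.
have VP := @vk_perms_sub R n b b_gt0.
split=> [hF|[c [g [c0 gL hE]]]].
  have [hP [_ [e [_ [F0 _]]]]] := hF.
  have [v Vv hv] := face_vk_perms hP F0.
  have [G [d [cone GL]]] := vk_perms_cone b_gt0 n_gt0 not_n1b1 Vv.
  by have [i [c [c0 hE]]] := facet_cone VP cone hF hv; exists c, (G i).
have [v [G [d [i [cone gE]]]]] := parking_ineqs_cone b_gt0 n_gt0 not_n1b1 gL.
have := cone_facet VP cone i; rewrite gE.
have hsE : halfspace h = halfspace g.
  by apply/funext => x; rewrite /halfspace/= hE dotZl ler_pM2l.
have hpE : hyperplane h = hyperplane g.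
  apply/funext => x; rewrite /hyperplane/= hE dotZl; apply/propext.
  by split=> [/mulfI|->] //; apply; rewrite gt_eqF.
by rewrite /facet_defining /valid hsE hpE.
Qed.

Lemma parking_simple : simple_polytope n P.
Proof.
have VP := @vk_perms_sub R n b b_gt0.
split=> [|v].
  have [G [d [cone _]]] := vk_perms_cone b_gt0 n_gt0 not_n1b1 (vk_perms_vk R b (leq0n n)).
  exact (cone_dim VP cone).
rewrite vertices_parking => Vv.
have [G [d [cone _]]] := vk_perms_cone b_gt0 n_gt0 not_n1b1 Vv.
exact (cone_edges_card VP cone).
Qed.

End Conclusion.

Theorem theorem2p3 (R : realType) (n : nat) (b : n.-tuple nat)
    (n_gt0 : (0 < n)%N) (b_gt0 : forall i : 'I_n, (0 < tnth b i)%N)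
    (not_n1b1 : ~ (n = 1%N /\ part b 1 = 1%N)) :
  [/\ simple_polytope n (parking_polytope R b),
      vertices (parking_polytope R b) =
        [set x | exists (s : {perm 'I_n}) (k : nat),
                   (k <= n)%N /\ x = perm_act s (vk R b k)] &
      [/\ minimal_description (parking_polytope R b) (parking_ineqs R b),
          (forall I : {set 'I_n}, (0 < #|I|)%N ->
             (\sum_(n - #|I| + 1 <= i < n.+1) psum b i)%N =
             (\sum_(1 <= j < n.+1) minn j #|I| * part b (n - j + 1))%N) &
          (* up to positive rescaling *)
          forall h : linear_ineq R n,
            facet_defining (parking_polytope R b) h <->
            exists (c : R) (g : linear_ineq R n),
              [/\ 0 < c, parking_ineqs R b g & h = (c *: g.1, c * g.2)]]].
Proof.
split; [exact: parking_simple | exact: vertices_parking | split].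
- exact: parking_minimal.
- by move=> I _; apply: topsum_minn; rewrite -[leqRHS]card_ord max_card.
- by move=> h; exact: facet_definingP.
Qed.
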